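(* For any odd degree $d=2r-1\ge 7$ (with $r$ an integer), there is a maximal Tjurina real line arrangement in $\mathbb P^2$ of type $(2r-1,r)$.
   Context: A line arrangement $\mathcal A$ in $\mathbb P^2$ (over a field of characteristic zero, e.g. $\mathbb C$) is a finite set of distinct lines, given by $f=0$ with $f\in S=\mathbb K[x,y,z]$ a product of $d$ pairwise non-proportional linear forms; it is real if these linear forms can be chosen with real coefficients. $r(\mathcal A)$ is the minimal degree $r$ for which there is a nonzero triple $(a,b,c)\in S_r^3$ with $af_x+bf_y+cf_z=0$. The global Tjurina number is $\tau(\mathcal A)=\sum_{j\ge 2}n_j(j-1)^2$, where $n_j$ is the number of points lying on exactly $j$ lines of $\mathcal A$. Set $\tau(d,r)_{max}=(d-1)(d-r-1)+r^2$ if $r<d/2$, and $\tau(d,r)_{max}=(d-1)(d-r-1)+r^2-\binom{2r-d+2}{2}$ if $d/2\le r\le d-1$. $\mathcal A$ is called maximal Tjurina of type $(d,r)$ if it has $d$ lines, $r(\mathcal A)=r$ and $\tau(\mathcal A)=\tau(d,r)_{max}$. *)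

(* Defs.v *)
From HB Require Import structures.
From mathcomp Require Import all_boot all_order all_algebra finmap mpoly.
From mathcomp Require Import boolp classical_sets cardinality reals.

Set Implicit Arguments.
Unset Strict Implicit.
Unset Printing Implicit Defensive.

Import GRing.Theory.
Local Open Scope ring_scope.

(* A line of P^2(K) is given by the coefficient vector of a linear form, so an
   arrangement is recorded with a choice of defining forms. *)
Record line_arrangement (K : fieldType) := LineArrangement {
  nlines : nat;
  line_coef : 'I_nlines -> 'rV[K]_3;
  line_coef_neq0 : forall i, line_coef i != 0;
  line_coef_nonprop : forall i j, i != j -> forall c : K, line_coef i != c *: line_coef j
}.
Arguments line_coef {K} _ _.

Definition linear_form (K : fieldType) (a : 'rV[K]_3) : {mpoly K[3]} :=
  \sum_(k < 3) a 0 k *: 'X_k.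

Definition defining_poly (K : fieldType) (A : line_arrangement K)
    : {mpoly K[3]} :=
  \prod_(i < nlines A) linear_form (line_coef A i).

(* [iota] embeds the reals in the base field K; "can be chosen" means up to
   rescaling each of the given forms. *)
Definition real_arrangement (R : realType) (K : fieldType)
    (iota : {rmorphism R -> K}) (A : line_arrangement K) : Prop :=
  forall i, exists c : K, exists b : 'rV[R]_3,
    c != 0 /\ line_coef A i = c *: map_mx iota b.

(* The zero polynomial belongs to [n.-homog] for every n, so [s.-homog] is the
   whole graded piece S_s. *)
Definition has_jacobian_syzygy (K : fieldType) (A : line_arrangement K)
    (s : nat) : Prop :=
  exists g : 'I_3 -> {mpoly K[3]},
    [/\ forall k, g k \is s.-homog,
        exists k, g k != 0 &
        \sum_(k < 3) g k * (defining_poly A)^`M(k) = 0].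

Definition is_mdr (K : fieldType) (A : line_arrangement K) (r : nat) : Prop :=
  has_jacobian_syzygy A r /\
  forall s, has_jacobian_syzygy A s -> (r <= s)%N.

(* A point of P^2(K) is a one-dimensional subspace p of K^3; it lies on the line
   with coefficients a when the form v |-> a . v vanishes on p. *)
Definition on_line (K : fieldType) (a : 'rV[K]_3) (p : {vspace 'rV[K]_3})
    : bool :=
  (p <= lker (linfun (mulmxr a^T)))%VS.

Definition point_mult (K : fieldType) (A : line_arrangement K)
    (p : {vspace 'rV[K]_3}) : nat :=
  #|[set i | on_line (line_coef A i) p]|.

Definition points_of_mult (K : fieldType) (A : line_arrangement K) (j : nat)
    : set {vspace 'rV[K]_3} :=
  [set p | (\dim p = 1)%N /\ point_mult A p = j]%classic.

(* [fset_set] returns the empty set on infinite sets; for j >= 2 the set of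
   points of multiplicity j is finite, so this is its true cardinality. *)
Definition nb_points (K : fieldType) (A : line_arrangement K) (j : nat) : nat :=
  #|` fset_set (points_of_mult A j)|%fset.

(* No point lies on more than [nlines A] lines. *)
Definition tjurina (K : fieldType) (A : line_arrangement K) : nat :=
  (\sum_(2 <= j < (nlines A).+1) nb_points A j * (j - 1) ^ 2)%N.

(* Meaningful for r <= d - 1, where no subtraction truncates. *)
Definition tau_max (d r : nat) : nat :=
  (if 2 * r < d then (d - 1) * (d - r - 1) + r ^ 2
   else (d - 1) * (d - r - 1) + r ^ 2 - 'C(2 * r - d + 2, 2))%N.

Definition maximal_tjurina (K : fieldType) (A : line_arrangement K)
    (d r : nat) : Prop :=
  [/\ nlines A = d, is_mdr A r & tjurina A = tau_max d r].

(* Main.v *)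
Require Import Defs.
From HB Require Import structures.
From mathcomp Require Import all_boot all_order all_algebra finmap mpoly.
From mathcomp Require Import boolp classical_sets cardinality reals.
From mathcomp Require Import ring zify.

Set Implicit Arguments.
Unset Strict Implicit.
Unset Printing Implicit Defensive.

Import GRing.Theory.
Local Open Scope ring_scope.

(** Put n = r - 2, so that n >= 2.  The arrangement consists of the 2n + 3 lines

      x = k y (0 <= k < n),   y = 0,
      z = l y (2 <= l < n + 2),   z = x,   z = x + y.

    In the affine chart y = 1, with coordinates (x, z), these are vertical,
    horizontal and diagonal lines together with the line at infinity, and all
    affine intersection points lie on the integer grid [0, n + 1]^2.  Let V
    be the n + 1 lines x = k y and y = 0, which pass through (0 : 0 : 1), and
    let H be the other n + 2 = r lines, of the form z = (a form in x and y).

    Tjurina number.  Of the intersection points, two at infinity lie on n + 1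
    lines and one on three; the multiplicity of a grid point (k, l) is the
    number of true statements among k < n, 2 <= l, l = k and l = k + 1.  Summing
    (multiplicity - 1)^2 gives 3 n^2 + 6 n + 1, which is tau_max (2 r - 1) r
    ([grid_tjurina]).

    A syzygy of degree r.  Write f = g h, with g and h the products of the forms
    of V and of H.  As g does not involve z, the derivation h d/dz maps f to
    h_z f, and subtracting h_z / d times the Euler derivation, with
    d = 2n + 3, leaves a derivation of degree r that kills f
    ([pencil_has_syzygy]).

    No syzygy of degree less than r.  A syzygy is a derivation t with t f = 0;
    after multiplication by a power of x it has degree r - 1 = n + 1.  Linear
    forms are prime, so every form of the arrangement divides its image under t
    ([syzygy_tangent]).  Hence w = x t(y) - y t(x), of degree n + 2, is divisible
    by g, and w = g u with u a linear form.  At a point where two lines of H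
    cross, t is proportional to the Euler derivation, so that w vanishes there;
    if no line of V passes through the point, u vanishes too.  The points
    (n, n), (n, n + 1) and (n + 1, n + 1) are of this kind and are not collinear,
    so u = 0 ([pencil_minor_eq0]).  For a form l of V, the polynomial
    l t(z) - z t(l), of degree n + 2, is then divisible by h and by l, too many
    factors for a nonzero polynomial.  So l t is a multiple of the Euler
    derivation, and t f = 0 forces t = 0 because the characteristic is zero
    ([pencil_syzygy_eq0]). *)

(** * Homogeneous polynomials *)

Section HomogeneousPolynomials.
Variables (n : nat) (K : fieldType).
Implicit Types F G : {mpoly K[n]}.

Lemma dhomog_mderiv d (i : 'I_n) F :
  F \is d.+1.-homog -> F^`M(i) \is d.-homog.
Proof.
move=> /dhomogP homF; rewrite [F]mpolyE raddf_sum /=.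
rewrite big_seq; apply: rpred_sum => m mF; rewrite linearZ /= mderivX.
have [->|mi0] := eqVneq (m i) 0%N; first by rewrite scale0r scaler0 rpred0.
apply/rpredZ/rpredZ; rewrite dhomogX /=.
by rewrite -eqSS -addn1 -(mdeg1 i) -mdegD submK ?lep1mP ?homF.
Qed.

(** This allows homogeneity of a factor to be read off from that of a product,
    one homogeneous component at a time. *)
Lemma pihomogM d k F G :
  F \is d.-homog -> pihomog mdeg (d + k) (F * G) = F * pihomog mdeg k G.
Proof.
move=> homF; rewrite [G in LHS]mpolyE mulr_sumr raddf_sum /=.
rewrite [pihomog _ k G]pihomogE [in RHS]big_mkcond /= mulr_sumr.
apply: eq_bigr => m _.
rewrite -scalerAr linearZ /=.
have homFm : F * 'X_[m] \is (d + mdeg m).-homog.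
  by apply: dhomogM; rewrite ?dhomogX.
case: eqP => [<-|mk]; first by rewrite pihomog_dE ?scalerAr.
rewrite (pihomog_ne0 (d := d + mdeg m)) ?scaler0 ?mulr0 //.
by rewrite eqn_add2l; apply/eqP.
Qed.

Lemma dhomog_factor d k F G : F != 0 ->
  F \is d.-homog -> F * G \is (d + k).-homog -> G \is k.-homog.
Proof.
move=> F0 homF homFG; rewrite homog_piE; apply/eqP.
by apply: (mulfI F0); rewrite -(pihomogM k G homF) pihomog_dE.
Qed.

Lemma dhomog_mul_eq0 d e F G : F != 0 -> (e < d)%N ->
  F \is d.-homog -> F * G \is e.-homog -> F * G = 0.
Proof.
move=> F0 ed homF homFG.
have G0 k : pihomog mdeg k G = 0.
  apply: (mulfI F0); rewrite mulr0 -(pihomogM k G homF).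
  by apply: (pihomog_ne0 _ homFG); lia.
by rewrite (pihomog_partitionE (leqnn (msize G))) big1 ?mulr0.
Qed.
End HomogeneousPolynomials.

(** * Linear forms in three variables *)

Lemma sum_ord3 (V : nmodType) (F : 'I_3 -> V) :
  \sum_(k < 3) F k = F 0 + F 1 + F 2.
Proof.
rewrite !big_ord_recl big_ord0 addr0 addrA; congr (_ + F _ + F _); exact: val_inj.
Qed.

Lemma ord3_ind (P : 'I_3 -> Prop) : P 0 -> P 1 -> P 2 -> forall k, P k.
Proof.
move=> P0 P1 P2 [[|[|[|//]]] lt_k].
- by rewrite (_ : Ordinal _ = 0) //; apply: val_inj.
- by rewrite (_ : Ordinal _ = 1) //; apply: val_inj.
- by rewrite (_ : Ordinal _ = 2) //; apply: val_inj.
Qed.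

Section LinearForms.
Variable K : fieldType.
Implicit Types (a b : 'rV[K]_3) (F G : {mpoly K[3]}) (g : 'I_3 -> {mpoly K[3]}).

Lemma linear_formB b c a :
  linear_form (b - c *: a) = linear_form b - c *: linear_form a.
Proof.
rewrite /linear_form scaler_sumr -sumrB; apply: eq_bigr => k _.
by rewrite !mxE scalerBl scalerA.
Qed.

Lemma mcoeff_linear_form a k : (linear_form a)@_U_(k) = a 0 k.
Proof.
rewrite raddf_sum (bigD1 k) //= mcoeffZ mcoeffX eqxx mulr1 big1 ?addr0 // => j jk.
by rewrite mcoeffZ mcoeffX eq_mnm1 (negPf jk) mulr0.
Qed.

Lemma linear_form_eq0 a : (linear_form a == 0) = (a == 0).
Proof.
apply/eqP/eqP => [a0|->]; last first.
  by rewrite /linear_form big1 // => k _; rewrite mxE scale0r.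
by apply/rowP => k; rewrite -mcoeff_linear_form a0 mcoeff0 mxE.
Qed.

Lemma dhomog_linear_form a : linear_form a \is 1.-homog.
Proof. by apply: rpred_sum => k _; apply: rpredZ; rewrite dhomogX /= mdeg1. Qed.

Lemma dhomog1_linear_form F :
  F \is 1.-homog -> F = linear_form (\row_k F@_U_(k)).
Proof.
move=> homF; have homL := dhomog_linear_form (\row_k F@_U_(k)).
apply/mpolyP => m; have [/eqP/mdeg1P[k /eqP ->]|m1] := eqVneq (mdeg m) 1%N.
  by rewrite mcoeff_linear_form mxE.
by rewrite (dhomog_nemf_coeff homF m1) (dhomog_nemf_coeff homL m1).
Qed.

Lemma mderiv_linear_form a k : (linear_form a)^`M(k) = (a 0 k)%:MP.
Proof.
rewrite raddf_sum (bigD1 k) //= mderivZ mderivX mnm1E eqxx scale1r.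
rewrite -{1}[U_(k)%MM]add0m addmK mpolyX0 -mul_mpolyC mulr1 big1 ?addr0 // => j jk.
by rewrite mderivZ mderivX mnm1E (negPf jk) scale0r scaler0.
Qed.

Lemma meval_linear_form a v :
  (linear_form a).@[v] = \sum_(k < 3) a 0 k * v k.
Proof.
by rewrite raddf_sum; apply: eq_bigr => k _ /=; rewrite mevalZ mevalXU.
Qed.

Definition form_dvd a F := exists G, F = linear_form a * G.

Lemma form_dvdD a F G : form_dvd a F -> form_dvd a G -> form_dvd a (F + G).
Proof. by move=> [H ->] [H' ->]; exists (H + H'); rewrite mulrDr. Qed.

Lemma form_dvdMl a F G : form_dvd a G -> form_dvd a (F * G).
Proof. by move=> [H ->]; exists (F * H); rewrite mulrCA. Qed.

Lemma form_dvd_root a F v :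
  form_dvd a F -> (linear_form a).@[v] = 0 -> F.@[v] = 0.
Proof. by move=> [G ->] av; rewrite mevalM av mul0r. Qed.

(** Substituting v - a(v) q for the variables v is restriction to the line a,
    realised inside the same polynomial ring: when a(q) = 1 it is composition with
    the projection onto the kernel of a along q.  Its kernel is the ideal of a,
    whence the primality of linear forms below. *)
Definition restriction a (q : 'I_3 -> K) F :=
  F \mPo [tuple 'X_k - q k *: linear_form a | k < 3].

Lemma restriction_form a q b :
  restriction a q (linear_form b)
    = linear_form b - (linear_form b).@[q] *: linear_form a.
Proof.
rewrite meval_linear_form scaler_suml /restriction [linear_form b]/linear_form.
rewrite raddf_sum -sumrB; apply: eq_bigr => k _ /=.
rewrite comp_mpolyZ comp_mpolyXU -tnth_nth tnth_mktuple.
by rewrite scalerBr scalerA.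
Qed.

(** The congruence holds for the variables and passes to sums and products. *)
Lemma restriction_congr a q F : form_dvd a (F - restriction a q F).
Proof.
pose P F := form_dvd a (F - restriction a q F); rewrite -/(P F).
have PM G H : P G -> P H -> P (G * H).
  move=> PG PH; rewrite /P /restriction rmorphM /= -!/(restriction _ _ _).
  rewrite (_ : _ - _ = G * (H - restriction a q H)
            + restriction a q H * (G - restriction a q G)); last by ring.
  by apply: form_dvdD; apply: form_dvdMl.
have P1 : P 1 by exists 0; rewrite /restriction rmorph1 subrr mulr0.
have PX k : P 'X_k.
  exists (q k)%:MP; rewrite /restriction comp_mpolyXU -tnth_nth tnth_mktuple.
  by rewrite opprB addrC subrK mulrC mul_mpolyC.
elim/mpolyind: F => [|c m F _ _ PF].
  by exists 0; rewrite /restriction rmorph0 subrr mulr0.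
have PXm : P 'X_[m].
  rewrite mpolyXE_id; apply: (big_ind P) => // k _.
  by elim: (m k) => [|j IH]; rewrite ?expr0 // exprS; apply: PM.
rewrite /P /restriction raddfD /= comp_mpolyZ -!/(restriction _ _ _).
rewrite opprD addrACA -scalerBr; apply: form_dvdD => //.
by rewrite -mul_mpolyC; apply: form_dvdMl.
Qed.

Lemma form_dvdP a q F : (linear_form a).@[q] = 1 ->
  form_dvd a F <-> restriction a q F = 0.
Proof.
move=> aq; split=> [[G ->]|F0]; last first.
  by have := restriction_congr a q F; rewrite F0 subr0.
rewrite /restriction rmorphM /= -!/(restriction _ _ _) restriction_form aq.
by rewrite scale1r subrr mul0r.
Qed.

Lemma transversal_point a :
  a != 0 -> exists q : 'I_3 -> K, (linear_form a).@[q] = 1.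
Proof.
case/rV0Pn => i ai; exists (fun k => (k == i)%:R / a 0 i).
rewrite meval_linear_form (bigD1 i) //= eqxx mul1r divff //.
by rewrite big1 ?addr0 // => k ki; rewrite (negPf ki) mul0r mulr0.
Qed.

(** A linear form is prime: its ideal is the kernel of a ring morphism into an
    integral domain. *)
Lemma form_dvdM a F G :
  a != 0 -> form_dvd a (F * G) -> form_dvd a F \/ form_dvd a G.
Proof.
move=> /transversal_point[q aq]; rewrite !(form_dvdP _ aq).
rewrite /restriction rmorphM /= => /eqP; rewrite mulf_eq0.
by case/orP => /eqP; [left | right].
Qed.

Lemma form_dvd_form a b :
  a != 0 -> form_dvd a (linear_form b) -> exists c, b = c *: a.
Proof.
move=> /transversal_point[q aq]; rewrite (form_dvdP _ aq) restriction_form.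
rewrite -linear_formB => /eqP; rewrite linear_form_eq0 subr_eq0 => /eqP ->.
by eexists.
Qed.

Lemma form_dvd_prod a (I : Type) (s : seq I) (P : pred I) (b : I -> 'rV[K]_3) :
  a != 0 -> (forall i, P i -> forall c, b i != c *: a) ->
  ~ form_dvd a (\prod_(i <- s | P i) linear_form (b i)).
Proof.
move=> a0 ab; apply: (big_ind (fun F => ~ form_dvd a F)) => [|F G nF nG|i Pi].
- case=> G /(congr1 (meval (fun=> 0))); rewrite meval1 mevalM meval_linear_form.
  rewrite big1 => [|k _]; last by rewrite mulr0.
  by rewrite mul0r => /eqP; rewrite oner_eq0.
- by case/form_dvdM.
- by case/form_dvd_form => // c bi; have /eqP := ab i Pi c.
Qed.

Definition distinct_lines (s : seq 'rV[K]_3) : Prop :=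
  [/\ uniq s, {in s, forall a, a != 0}
    & {in s &, forall a b, a != b -> forall c, a != c *: b}].

Lemma distinct_lines_sub s t :
  uniq t -> {subset t <= s} -> distinct_lines s -> distinct_lines t.
Proof.
move=> ut ts [_ nz np]; split=> // [a /ts|a b /ts a_in /ts b_in]; first exact: nz.
exact: np.
Qed.

Lemma prod_forms_neq0 s :
  distinct_lines s -> \prod_(a <- s) linear_form a != 0.
Proof.
case=> _ nz _; rewrite prodf_seq_neq0; apply/allP => a /nz /=.
by rewrite linear_form_eq0.
Qed.

Lemma prod_form_dvd (s : seq 'rV[K]_3) F :
  distinct_lines s -> {in s, forall a, form_dvd a F} ->
  exists G, F = (\prod_(a <- s) linear_form a) * G.
Proof.
elim: s F => [|a s IH] F; first by exists F; rewrite big_nil mul1r.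
move=> ds dv; have [/= /andP[nas us] nz np] := ds.
have ds' : distinct_lines s.
  by apply: distinct_lines_sub ds => // b bs; rewrite inE bs orbT.
have [G FG] := dv a (mem_head _ _).
have [b bs|H GH] := IH G ds'; last by exists H; rewrite FG GH big_cons mulrA.
have bas : b \in a :: s by rewrite inE bs orbT.
have := dv b bas; rewrite FG => /(form_dvdM (nz b bas))[] //.
case/(form_dvd_form (nz b bas)) => c /eqP; rewrite (negPf (np _ _ _ _ _ c)) //.
  exact: mem_head.
by apply: contraNneq nas => ->.
Qed.

Definition derivation g F := \sum_(k < 3) g k * F^`M(k).

Lemma derivationM g F G :
  derivation g (F * G) = derivation g F * G + F * derivation g G.
Proof.
rewrite /derivation mulr_suml mulr_sumr -big_split; apply: eq_bigr => k _ /=.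
by rewrite mderivM; ring.
Qed.

Lemma derivation_linear_form g a :
  derivation g (linear_form a) = \sum_(k < 3) a 0 k *: g k.
Proof.
apply: eq_bigr => k _.
by rewrite mderiv_linear_form mulrC mul_mpolyC.
Qed.

(** From 0 = t(a h) = t(a) h + a t(h), with h the product of the other forms,
    the prime a divides t(a) h, and it does not divide h.  Geometrically, a
    derivation that kills the defining polynomial is tangent to every line. *)
Lemma syzygy_tangent s g a :
  distinct_lines s -> a \in s ->
  derivation g (\prod_(b <- s) linear_form b) = 0 ->
  form_dvd a (\sum_(k < 3) a 0 k *: g k).
Proof.
move=> [us nz np] a_in; rewrite (bigD1_seq a) //= derivationM => /eqP.
rewrite addr_eq0 big_seq_cond -derivation_linear_form => /eqP.
set h := \prod_(b <- s | _) _ => dvd_a.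
have : form_dvd a (derivation g (linear_form a) * h).
  by rewrite dvd_a; exists (- derivation g h); rewrite mulrN.
case/(form_dvdM (nz a a_in)) => // /form_dvd_prod; case; first exact: nz.
by move=> b /andP[b_in ba] c; apply: np.
Qed.

Lemma euler_prod_forms (I : Type) (s : seq I) (b : I -> 'rV[K]_3) :
  derivation (fun k => 'X_k) (\prod_(i <- s) linear_form (b i))
    = (\prod_(i <- s) linear_form (b i)) *+ size s.
Proof.
elim: s => [|i s IH]; rewrite ?big_nil ?big_cons /=.
  by rewrite /derivation big1 // => k _; rewrite mderivC mulr0.
by rewrite derivationM IH derivation_linear_form mulrnAr mulrS.
Qed.

Lemma dhomog_prod_forms (I : Type) (s : seq I) (b : I -> 'rV[K]_3) :
  \prod_(i <- s) linear_form (b i) \is (size s).-homog.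
Proof.
elim: s => [|i s IH]; rewrite ?big_nil ?big_cons /= ?dhomog1 //.
exact: dhomogM (dhomog_linear_form _) IH.
Qed.
End LinearForms.

(** * Syzygies of an arrangement with a pencil of lines *)

(** The lines of V pass through the point (0 : 0 : 1) and those of H avoid it.
    Below, t is the derivation with components [g], and f is the product of all
    the forms, d in number. *)
Section PencilPoint.
Variables (K : fieldType) (V H : seq 'rV[K]_3).
Hypothesis linesVH : distinct_lines (V ++ H).
Hypothesis Vz : {in V, forall a : 'rV[K]_3, a 0 2 = 0}.
Hypothesis Hz : {in H, forall a : 'rV[K]_3, a 0 2 = 1}.

Local Notation x := ('X_0 : {mpoly K[3]}).
Local Notation y := ('X_1 : {mpoly K[3]}).
Local Notation z := ('X_2 : {mpoly K[3]}).

Let inV a : a \in V -> a \in V ++ H. Proof. by rewrite mem_cat => ->. Qed.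
Let inH a : a \in H -> a \in V ++ H.
Proof. by rewrite mem_cat orbC => ->. Qed.

Let linesV : distinct_lines V.
Proof.
apply: distinct_lines_sub linesVH => //.
by case: linesVH; rewrite cat_uniq => /and3P[].
Qed.

Let sumE (g : 'I_3 -> {mpoly K[3]}) (a : 'rV[K]_3) :
  \sum_(k < 3) a 0 k *: g k
    = (a 0 0)%:MP * g 0 + (a 0 1)%:MP * g 1 + (a 0 2)%:MP * g 2.
Proof. by rewrite sum_ord3 !mul_mpolyC. Qed.

Let formE (a : 'rV[K]_3) :
  linear_form a = (a 0 0)%:MP * x + (a 0 1)%:MP * y + (a 0 2)%:MP * z.
Proof. exact: sumE. Qed.

Variables (g : 'I_3 -> {mpoly K[3]}).
Hypothesis homg : forall k, g k \is (size V).-homog.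
Hypothesis syz : derivation g (\prod_(a <- V ++ H) linear_form a) = 0.
Let tangent a : a \in V ++ H -> form_dvd a (\sum_(k < 3) a 0 k *: g k).
Proof. by move=> a_in; apply: syzygy_tangent linesVH a_in syz. Qed.
Variable P : 'I_3 -> 'I_3 -> K.
Hypothesis P_span : forall c : 'rV[K]_3,
  (forall i, (linear_form c).@[P i] = 0) -> c = 0.
Hypothesis P_off : forall i, {in V, forall a, (linear_form a).@[P i] != 0}.
Hypothesis P_on : forall i, exists a b, [/\ a \in H, b \in H, a != b,
  (linear_form a).@[P i] = 0 & (linear_form b).@[P i] = 0].

(** The minor x t(y) - y t(x) vanishes on the lines of V, and after division by
    their product a linear form u is left.  The minor also vanishes at each
    P i: there both (x, y) and (t(x), t(y)) are killed by the difference of two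
    forms of H through P i, a nonzero form in x and y alone.  So u vanishes at
    the three points P i, which are not collinear. *)
Lemma pencil_minor_eq0 : x * g 1 = y * g 0.
Proof.
pose w := x * g 1 - y * g 0.
suff w0 : w = 0 by apply/eqP; rewrite -subr_eq0; apply/eqP.
have homw : w \is (size V + 1).-homog.
  have homX (k l : 'I_3) : 'X_k * g l \is (size V + 1).-homog.
    by rewrite mulrC; apply: dhomogM (homg _) _; rewrite dhomogX /= mdeg1.
  by apply: rpredB; apply: homX.
have wV : {in V, forall a, form_dvd a w}.
  move=> a aV; have := tangent (inV aV); rewrite sumE (Vz aV) => -[u].
  rewrite mpolyC0 mul0r addr0 => au.
  (* One of the two coefficients of [a] is nonzero; w may be scaled by it. *)
  have scaled k : a 0 k != 0 -> form_dvd a ((a 0 k)%:MP * w) -> form_dvd a w.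
    move=> ak [v av]; exists ((a 0 k)^-1%:MP * v).
    by rewrite mulrCA -av mulrA -mpolyCM mulVf // mul1r.
  have [a0|a0] := eqVneq (a 0 0) 0; last first.
    apply: (scaled 0) => //; exists (g 1 - y * u).
    rewrite formE (Vz aV) mpolyC0 mul0r addr0 /w.
    transitivity ((a 0 0)%:MP * x * g 1 + (a 0 1)%:MP * y * g 1
      - y * ((a 0 0)%:MP * g 0 + (a 0 1)%:MP * g 1)); first by ring.
    by rewrite au formE (Vz aV) mpolyC0; ring.
  have [a1|a1] := eqVneq (a 0 1) 0; last first.
    apply: (scaled 1) => //; exists (x * u - g 0).
    rewrite formE (Vz aV) mpolyC0 mul0r addr0 /w.
    transitivity (x * ((a 0 0)%:MP * g 0 + (a 0 1)%:MP * g 1)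
      - ((a 0 0)%:MP * x + (a 0 1)%:MP * y) * g 0); first by ring.
    by rewrite au formE (Vz aV) mpolyC0; ring.
  suff a00 : a = 0 by have [_ /(_ a aV)] := linesV; rewrite a00 eqxx.
  by apply/rowP => k; rewrite mxE; elim/ord3_ind: k => //; apply: Vz.
have [u wu] := prod_form_dvd linesV wV.
have /dhomog1_linear_form uE : u \is 1.-homog.
  apply: dhomog_factor (prod_forms_neq0 linesV) (dhomog_prod_forms V id) _.
  by rewrite -wu.
rewrite wu uE [X in linear_form X]P_span ?linear_form_eq0.
  by apply/eqP; rewrite mulf_eq0 linear_form_eq0 eqxx orbT.
move=> i; rewrite -uE.
have gV : (\prod_(a <- V) linear_form a).@[P i] != 0.
  rewrite rmorph_prod prodf_seq_neq0; apply/allP => a aV /=.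
  exact: P_off.
apply: (mulfI gV); rewrite mulr0 -mevalM -wu.
have [a [b [aH bH ab Pa Pb]]] := P_on i.
have ga := form_dvd_root (tangent (inH aH)) Pa.
have gb := form_dvd_root (tangent (inH bH)) Pb.
move: Pa Pb ga gb; rewrite !sumE !formE !Hz // !mpolyC1 !mul1r.
rewrite /w !(mevalD, mevalN, mevalM, mevalXU, mevalC).
set X := P i 0; set Y := P i 1; set Z := P i 2.
set A := (g 0).@[_]; set B := (g 1).@[_]; set C := (g 2).@[_].
move=> Pa Pb ga gb.
have e0 : (a 0 0 - b 0 0) * (X * B - Y * A) = 0.
  transitivity (B * ((a 0 0 * X + a 0 1 * Y + Z) - (b 0 0 * X + b 0 1 * Y + Z))
    - Y * ((a 0 0 * A + a 0 1 * B + C) - (b 0 0 * A + b 0 1 * B + C))).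
    by ring.
  by rewrite Pa Pb ga gb subrr !mulr0 subrr.
have e1 : (a 0 1 - b 0 1) * (X * B - Y * A) = 0.
  transitivity (X * ((a 0 0 * A + a 0 1 * B + C) - (b 0 0 * A + b 0 1 * B + C))
    - A * ((a 0 0 * X + a 0 1 * Y + Z) - (b 0 0 * X + b 0 1 * Y + Z))).
    by ring.
  by rewrite Pa Pb ga gb subrr !mulr0 subrr.
apply/eqP; apply: contraNT ab => nz; apply/eqP/rowP => k.
move/eqP: e0; rewrite mulf_eq0 (negPf nz) orbF subr_eq0 => /eqP e0.
move/eqP: e1; rewrite mulf_eq0 (negPf nz) orbF subr_eq0 => /eqP e1.
by elim/ord3_ind: k; rewrite // !Hz.
Qed.

Hypothesis size_VH : (size V < size H)%N.
Hypothesis V_neq0 : (0 < size V)%N.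
Hypothesis sizeK : (size (V ++ H))%:R != 0 :> K.

(** For a form l of V, the first minor being zero gives x t(l) = l t(x) and
    y t(l) = l t(y).  The polynomial l t(z) - z t(l) is then divisible by l and
    by all forms of H, more factors than its degree allows, so it is zero too.
    Hence t(l) times the Euler derivation is l times t, and applying both to f
    gives t(l) d f = 0. *)
Lemma pencil_syzygy_eq0 k : g k = 0.
Proof.
have gxy := pencil_minor_eq0.
have [l lV] : exists l, l \in V.
  by case: V V_neq0 => // l s _; exists l; apply: mem_head.
have lz := Vz lV; have := tangent (inV lV).
set dl := \sum_(k < 3) _ => dvd_dl.
have dlE : dl = (l 0 0)%:MP * g 0 + (l 0 1)%:MP * g 1.
  by rewrite /dl sumE lz mpolyC0 mul0r addr0.
have lE : linear_form l = (l 0 0)%:MP * x + (l 0 1)%:MP * y.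
  by rewrite formE lz mpolyC0 mul0r addr0.
have radial0 : x * dl = linear_form l * g 0.
  transitivity ((l 0 0)%:MP * x * g 0 + (l 0 1)%:MP * (x * g 1)).
    by rewrite dlE; ring.
  by rewrite gxy lE; ring.
have radial1 : y * dl = linear_form l * g 1.
  transitivity ((l 0 0)%:MP * (y * g 0) + (l 0 1)%:MP * y * g 1).
    by rewrite dlE; ring.
  by rewrite -gxy lE; ring.
have radial2 : z * dl = linear_form l * g 2.
  pose v := linear_form l * g 2 - z * dl.
  suff v0 : v = 0 by apply/eqP; rewrite eq_sym -subr_eq0; apply/eqP.
  have homv : v \is (1 + size V).-homog.
    apply: rpredB; apply: dhomogM => //; rewrite ?dhomog_linear_form //.
      by rewrite dhomogX /= mdeg1.
    by apply: rpred_sum => i _; apply: rpredZ.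
  have lH : distinct_lines (l :: H).
    have [uVH _ _] := linesVH; move: uVH; rewrite cat_uniq => /and3P[_ VH uH].
    apply: distinct_lines_sub linesVH => /= [|a].
      rewrite uH andbT; apply: contra VH => lH; apply/hasP; by exists l.
    by rewrite inE => /predU1P[->|/inH //]; apply: inV.
  have [|u vu] := @prod_form_dvd K (l :: H) v lH.
    move=> a; rewrite inE => /predU1P[->|aH].
      case: dvd_dl => u dlu; exists (g 2 - z * u).
      by rewrite /v dlu; ring.
    have [u au] := tangent (inH aH); exists (linear_form l * u - dl).
    move: au; rewrite sumE formE Hz // mpolyC1 !mul1r => au.
    transitivity (linear_form l * ((a 0 0)%:MP * g 0 + (a 0 1)%:MP * g 1 + g 2)
      - (a 0 0)%:MP * (linear_form l * g 0) - (a 0 1)%:MP * (linear_form l * g 1)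
      - z * dl); first by rewrite /v; ring.
    by rewrite au -radial0 -radial1; ring.
  rewrite vu; apply: dhomog_mul_eq0 (prod_forms_neq0 lH) _
    (dhomog_prod_forms (l :: H) id) _; last by rewrite -vu; exact: homv.
  by [].
have dl0 : dl = 0.
  pose f := \prod_(a <- V ++ H) linear_form a; have syzf : derivation g f = 0 := syz.
  have fd : dl * (f *+ size (V ++ H)) = 0.
    rewrite -euler_prod_forms -/f -[RHS](mulr0 (linear_form l)) -syzf.
    rewrite /derivation !sum_ord3 !mulrDr !mulrA.
    by rewrite -radial0 -radial1 -radial2 ![dl * 'X_ _]mulrC.
  apply/eqP; move/eqP: fd; rewrite -mulr_natr mulrA mulf_eq0 => /orP[|].
    by rewrite mulf_eq0 (negPf (prod_forms_neq0 linesVH)) orbF.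
  by rewrite -mpolyC_nat mpolyC_eq0 (negPf sizeK).
have l0 : linear_form l != 0.
  by rewrite linear_form_eq0; have [_ /(_ l lV)] := linesV.
apply: (mulfI l0); rewrite mulr0.
have lgk : linear_form l * g k = 'X_k * dl.
  by elim/ord3_ind: k.
by rewrite lgk dl0 mulr0.
Qed.
End PencilPoint.

(** * Arrangements given by a list of forms *)

Section ArrangementOfSeq.
Variables (K : fieldType) (s : seq 'rV[K]_3).
Hypothesis lines_s : distinct_lines s.

Fact seq_coef_neq0 (i : 'I_(size s)) : s`_i != 0.
Proof. by have [_ nz _] := lines_s; apply/nz/mem_nth. Qed.

Fact seq_coef_nonprop (i j : 'I_(size s)) :
  i != j -> forall c, s`_i != c *: s`_j.
Proof.
have [us _ np] := lines_s.
by move=> ij; apply: np; rewrite ?mem_nth // nth_uniq.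
Qed.

Definition seq_arrangement : line_arrangement K :=
  LineArrangement seq_coef_neq0 seq_coef_nonprop.

Lemma defining_poly_seq :
  defining_poly seq_arrangement = \prod_(a <- s) linear_form a.
Proof. by rewrite (big_nth 0) big_mkord. Qed.

Lemma point_mult_seq p :
  point_mult seq_arrangement p = count (on_line (K := K) ^~ p) s.
Proof.
rewrite /point_mult -sum1_card -sum1_count (big_nth 0) big_mkord.
by apply: eq_bigl => i; rewrite inE.
Qed.
End ArrangementOfSeq.

(** Points on at most one line contribute (m - 1)^2 = 0 with truncated
    subtraction, so the list may be any one that contains the multiple points. *)
Lemma tjurina_sum (K : fieldType) (A : line_arrangement K)
    (s : seq {vspace 'rV[K]_3}) :
  uniq s -> {in s, forall p, \dim p = 1%N} ->
  (forall p, \dim p = 1%N -> (1 < point_mult A p)%N -> p \in s) ->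
  tjurina A = (\sum_(p <- s) (point_mult A p - 1) ^ 2)%N.
Proof.
move=> us dim_s all_s.
have nbE j : (1 < j)%N ->
    nb_points A j = (\sum_(p <- s) (point_mult A p == j))%N.
  move=> j1; rewrite /nb_points.
  have -> : points_of_mult A j
      = [set` [fset p in [seq p <- s | point_mult A p == j]]%fset]%classic.
    apply/seteqP; split=> p /=; rewrite inE mem_filter.
      by case=> dp pj; rewrite pj eqxx all_s // pj.
    by case/andP => /eqP pj /dim_s dp.
  rewrite set_fsetK card_fseq undup_id ?filter_uniq //.
  by rewrite size_filter -sum1_count big_mkcond.
rewrite /tjurina (eq_big_nat _ _ (F2 := fun j =>
  (\sum_(p <- s) (point_mult A p == j) * (j - 1) ^ 2)%N)); last first.
  by move=> j /andP[j1 _]; rewrite nbE // big_distrl.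
rewrite exchange_big /=; apply: eq_bigr => p _.
have mult_le : (point_mult A p < (nlines A).+1)%N.
  by rewrite ltnS -[leqRHS]card_ord max_card.
have [m1|m1] := ltnP 1 (point_mult A p).
  rewrite (bigD1_seq (point_mult A p)) ?mem_index_iota ?m1 ?iota_uniq //=.
  rewrite eqxx mul1n big1 ?addn0 // => j jm.
  by rewrite eq_sym (negPf jm).
rewrite big_nat_cond big1 => [|j]; first by case: point_mult m1 => [|[]].
by rewrite andbT => /andP[j1 _]; rewrite ltn_eqF // (leq_ltn_trans m1).
Qed.

(** * Minimal degree of a syzygy *)

Section PencilMdr.
Variables (K : fieldType) (V H : seq 'rV[K]_3).
Hypothesis linesVH : distinct_lines (V ++ H).
Hypothesis Vz : {in V, forall a : 'rV[K]_3, a 0 2 = 0}.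
Hypothesis sizeK : (size (V ++ H))%:R != 0 :> K.

(** Up to the factor d, this is h d/dz - (h_z / d) E, with E the Euler
    derivation and h the product of the forms of H. *)
Lemma pencil_has_syzygy : (0 < size H)%N ->
  has_jacobian_syzygy (seq_arrangement linesVH) (size H).
Proof.
move=> H_neq0.
pose h := \prod_(a <- H) linear_form a; pose hz := h^`M(2).
pose d : {mpoly K[3]} := (size (V ++ H))%:R.
have homhz : hz \is (size H).-1.-homog.
  by apply: dhomog_mderiv; rewrite prednK // dhomog_prod_forms.
have homX k : hz * 'X_k \is (size H).-homog.
  rewrite -(prednK H_neq0) -[X in X.-homog]addn1; apply: dhomogM => //.
  by rewrite dhomogX /= mdeg1.
have homh : d * h \is (size H).-homog.
  by rewrite /d mulr_natl rpredMn // dhomog_prod_forms.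
exists (fun k => (if k == 2 then d * h else 0) - hz * 'X_k); split.
- by move=> k; case: ifP => _; rewrite rpredB ?rpred0.
- (* If h_z were zero, the last component would be d h. *)
  have [hz0|hz0] := eqVneq hz 0; last first.
    by exists 0; rewrite /= sub0r oppr_eq0 mulf_neq0 // -msupp_eq0 msuppX.
  exists 2; rewrite /= hz0 mul0r subr0 mulf_neq0 //.
    by rewrite /d -mpolyC_nat mpolyC_eq0.
  by apply: prod_forms_neq0; apply: distinct_lines_sub linesVH => [|a aH];
     [case: linesVH; rewrite cat_uniq => /and3P[] | rewrite mem_cat aH orbT].
rewrite defining_poly_seq; set f := \prod_(a <- _) _.
have fz : f^`M(2) = \prod_(a <- V) linear_form a * hz.
  rewrite /f big_cat /= mderivM (_ : (\prod_(a <- V) _)^`M(2) = 0).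
    by rewrite mul0r add0r.
  elim: (V) Vz => [_|a s IH sz]; first by rewrite big_nil mderivC.
  rewrite big_cons mderivM mderiv_linear_form sz ?mem_head //.
  by rewrite mpolyC0 mul0r add0r IH ?mulr0 // => b bs; rewrite sz // inE bs orbT.
have eulerf := euler_prod_forms (V ++ H) id.
move: eulerf; rewrite -/f /derivation !sum_ord3 /= => eulerf.
transitivity (d * h * f^`M(2)
  - hz * ('X_0 * f^`M(0) + 'X_1 * f^`M(1) + 'X_2 * f^`M(2))); first by ring.
by rewrite eulerf fz /f big_cat /= -mulr_natr -/h -/d; ring.
Qed.

Hypothesis Hz : {in H, forall a : 'rV[K]_3, a 0 2 = 1}.
Variable P : 'I_3 -> 'I_3 -> K.
Hypothesis P_span : forall c : 'rV[K]_3,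
  (forall i, (linear_form c).@[P i] = 0) -> c = 0.
Hypothesis P_off : forall i, {in V, forall a, (linear_form a).@[P i] != 0}.
Hypothesis P_on : forall i, exists a b, [/\ a \in H, b \in H, a != b,
  (linear_form a).@[P i] = 0 & (linear_form b).@[P i] = 0].
Hypothesis size_VH : size H = (size V).+1.
Hypothesis V_neq0 : (0 < size V)%N.

Lemma pencil_mdr : is_mdr (seq_arrangement linesVH) (size H).
Proof.
split=> [|e [g [homg [k gk] syz]]]; first by apply: pencil_has_syzygy; rewrite size_VH.
rewrite size_VH ltnNge; apply: contraNN gk => le_eV.
(* Multiplying by a power of x brings the degree up to [size V]. *)
pose g' i := 'X_0 ^+ (size V - e) * g i.
have homg' i : g' i \is (size V).-homog.
  rewrite -(subnK le_eV); apply: dhomogM => //.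
  rewrite -[X in X.-homog]mul1n; apply: dhomogMn.
  by rewrite dhomogX /= mdeg1.
have syz' : derivation g' (\prod_(a <- V ++ H) linear_form a) = 0.
  rewrite -defining_poly_seq -[RHS](mulr0 ('X_0 ^+ (size V - e))) -syz.
  by rewrite mulr_sumr; apply: eq_bigr => i _; rewrite mulrA.
have lt_VH : (size V < size H)%N by rewrite size_VH.
have /eqP := pencil_syzygy_eq0 linesVH Vz Hz homg' syz' P_span P_off P_on
  lt_VH V_neq0 sizeK k.
have X0 : ('X_0 : {mpoly K[3]}) != 0 by rewrite -msupp_eq0 msuppX.
by rewrite mulf_eq0 expf_eq0 (negPf X0) andbF.
Qed.
End PencilMdr.

(** * Lines and points in coordinates *)

Section Coordinates.
Variable K : fieldType.
Implicit Types (a b v : 'rV[K]_3) (x y z : K).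

Definition coords x y z : 'rV[K]_3 := \row_(k < 3) [:: x; y; z]`_k.

Lemma coordsE x y z :
  ((coords x y z 0 0 = x) * (coords x y z 0 1 = y) * (coords x y z 0 2 = z))%type.
Proof. by rewrite !mxE. Qed.

Lemma row3P a b :
  a 0 0 = b 0 0 -> a 0 1 = b 0 1 -> a 0 2 = b 0 2 -> a = b.
Proof. by move=> e0 e1 e2; apply/rowP; elim/ord3_ind. Qed.

Lemma coords_inj x y z x' y' z' :
  coords x y z = coords x' y' z' -> [/\ x = x', y = y' & z = z'].
Proof.
by move=> /rowP e; move: (e 0) (e 1) (e 2); rewrite !coordsE.
Qed.

(** The first nonzero coordinate in the order sigma (0 for the zero vector).
    Normalising it to 1 selects one vector on each line through the origin. *)
Definition lead_coord (sigma : seq 'I_3) a : K :=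
  head 0 [seq c <- [seq a 0 k | k <- sigma] | c != 0].

Lemma lead_coordZ sigma c a :
  lead_coord sigma (c *: a) = c * lead_coord sigma a.
Proof.
rewrite /lead_coord; elim: sigma => [|k sigma IH] /=; first by rewrite mulr0.
rewrite mxE mulf_eq0; move: IH; have [->|c0] /= := eqVneq c 0; last by case: ifP.
by rewrite !mul0r.
Qed.

Lemma normalized_distinct_lines sigma (s : seq 'rV[K]_3) :
  uniq s -> {in s, forall a, lead_coord sigma a = 1} -> distinct_lines s.
Proof.
move=> us lead1; split=> // [a a_in|a b a_in b_in ab c].
  apply/eqP => a0; have /eqP := lead1 a a_in.
  by rewrite a0 -(scale0r 0) lead_coordZ mul0r eq_sym oner_eq0.
apply: contraNneq ab => ac; have := lead1 a a_in.
by rewrite ac lead_coordZ lead1 // mulr1 => ->; rewrite scale1r.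
Qed.

Definition incident a v := (linear_form a).@[v 0] == 0.

Lemma incidentE a v :
  incident a v = (a 0 0 * v 0 0 + a 0 1 * v 0 1 + a 0 2 * v 0 2 == 0).
Proof. by rewrite /incident meval_linear_form sum_ord3. Qed.

Lemma on_line_vline a v : on_line a <[v]>%VS = incident a v.
Proof.
rewrite /on_line -memvE memv_ker lfunE /= /incident meval_linear_form.
apply/eqP/eqP => [/rowP/(_ 0)|av].
  by rewrite !mxE => e; rewrite -[RHS]e; apply: eq_bigr => k _; rewrite !mxE mulrC.
apply/rowP => i; rewrite !mxE -[RHS]av; apply: eq_bigr => k _.
by rewrite !mxE ord1 mulrC.
Qed.

Lemma dim1_vline (p : {vspace 'rV[K]_3}) :
  \dim p = 1%N -> exists2 v, v != 0 & p = <[v]>%VS.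
Proof.
move=> dp; have p0 : p != 0%VS by rewrite -dimv_eq0 dp.
have v0 : vpick p != 0 by rewrite vpick0.
exists (vpick p) => //; apply/esym/eqP.
by rewrite eqEdim dp dim_vline v0 andbT -memvE memv_pick.
Qed.

Lemma vlineZ c v : c != 0 -> <[c *: v]>%VS = <[v]>%VS.
Proof.
move=> c0; apply/vspaceP => w; apply/vlineP/vlineP => -[k ->].
  by exists (k * c); rewrite scalerA.
by exists (k / c); rewrite scalerA divfK.
Qed.

Lemma uniq_vlines (s : seq 'rV[K]_3) :
  distinct_lines s -> uniq [seq <[v]>%VS | v <- s].
Proof.
case=> us _ np; rewrite map_inj_in_uniq // => v w v_in w_in /vspaceP/(_ v).
rewrite memv_line => /esym/vlineP[c vw].
by apply/eqP; case: eqVneq => // /(np v w v_in w_in)/(_ c); rewrite vw eqxx.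
Qed.
End Coordinates.

(** * The slanted grid *)

Section SlantedGrid.
Variables (K : fieldType) (n : nat).

Definition vertical j : 'rV[K]_3 := coords 1 (- j%:R) 0.
Definition horizontal j : 'rV[K]_3 := coords 0 (- j%:R) 1.
Definition line_at_infinity : 'rV[K]_3 := coords 0 1 0.
Definition diagonal : 'rV[K]_3 := coords (-1) 0 1.
Definition diagonal_succ : 'rV[K]_3 := coords (-1) (-1) 1.

Definition grid_vert :=
  [seq vertical j | j <- iota 0 n] ++ [:: line_at_infinity].
Definition grid_hor :=
  [seq horizontal j | j <- iota 2 n] ++ [:: diagonal; diagonal_succ].

Definition grid_pt (k l : nat) : 'rV[K]_3 := coords k%:R 1 l%:R.

(** The multiple points are among these: the affine ones lie on the square grid,
    and the three others are the directions of the verticals, of the horizontals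
    and of the diagonals. *)
Definition grid_points :=
  [seq grid_pt k l | k <- iota 0 n.+2, l <- iota 0 n.+2] ++
  [:: coords 0 0 1; coords 1 0 0; coords 1 0 1].

Hypothesis natK : forall j k : nat, (j%:R == k%:R :> K) = (j == k).

Lemma incident_grid v j :
  [/\ incident (vertical j) v = (v 0 0 == j%:R * v 0 1),
      incident (horizontal j) v = (v 0 2 == j%:R * v 0 1),
      incident line_at_infinity v = (v 0 1 == 0),
      incident diagonal v = (v 0 2 == v 0 0)
    & incident diagonal_succ v = (v 0 2 == v 0 0 + v 0 1)].
Proof.
split; rewrite incidentE !coordsE ?(mul0r, mul1r, mulN1r, addr0, add0r, mulNr).
- by rewrite subr_eq0.
- by rewrite addrC subr_eq0.
- by [].
- by rewrite addrC subr_eq0.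
- by rewrite -opprD addrC subr_eq0.
Qed.

Lemma incident_grid_pt k l j :
  [/\ incident (vertical j) (grid_pt k l) = (j == k),
      incident (horizontal j) (grid_pt k l) = (j == l),
      incident line_at_infinity (grid_pt k l) = false,
      incident diagonal (grid_pt k l) = (l == k)
    & incident diagonal_succ (grid_pt k l) = (l == k.+1)].
Proof.
have [-> -> -> -> ->] := incident_grid (grid_pt k l) j.
rewrite !coordsE !mulr1 !natK oner_eq0 natr1 natK.
by rewrite [k == j]eq_sym [l == j]eq_sym.
Qed.

Lemma distinct_grid_lines : distinct_lines (grid_vert ++ grid_hor).
Proof.
apply: (@normalized_distinct_lines _ [:: 2; 0; 1]); last first.
  move=> a; rewrite !mem_cat !inE.
  by case/orP => /orP[/mapP[j _ ->]|]; [|move/eqP->| |case/orP => /eqP->];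
    rewrite /lead_coord /= !coordsE ?eqxx /= ?oner_eq0 ?oppr_eq0 ?oner_eq0.
have inj j k : - j%:R = - k%:R :> K -> j = k.
  by move=> /oppr_inj/eqP; rewrite natK => /eqP.
rewrite !cat_uniq !map_inj_uniq ?iota_uniq /=; last 2 first.
- by move=> j k /coords_inj[_ /inj].
- by move=> j k /coords_inj[_ /inj].
rewrite !orbF !andbT; apply/and4P; split.
- apply/mapP => -[j _ /coords_inj[/eqP]].
  by rewrite eq_sym oner_eq0.
- apply/hasPn => a a_hor; apply/negP => a_vert.
  have a1 : a 0 2 = 1.
    move: a_hor; rewrite mem_cat !inE => /orP[/mapP[j _ ->]|];
      last case/orP => /eqP->; by rewrite coordsE.
  have a0 : a 0 2 = 0.
    move: a_vert; rewrite mem_cat !inE => /orP[/mapP[j _ ->]|/eqP->];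
      by rewrite coordsE.
  by have /eqP := a1; rewrite a0 eq_sym oner_eq0.
- rewrite negb_or; apply/andP; split; apply/mapP => -[j _ /coords_inj[/eqP]];
    by rewrite oppr_eq0 oner_eq0.
- rewrite inE; apply/eqP => /coords_inj[_ /eqP].
  by rewrite eq_sym oppr_eq0 oner_eq0.
Qed.

Lemma distinct_grid_points : distinct_lines grid_points.
Proof.
apply: (@normalized_distinct_lines _ [:: 1; 0; 2]); last first.
  move=> a; rewrite mem_cat => /orP[/allpairsP[[k l] [_ _ ->]]|]; last first.
    by rewrite !inE => /or3P[]/eqP->;
       rewrite /lead_coord /= !coordsE ?eqxx /= ?oner_eq0 ?eqxx /= ?oner_eq0.
  by rewrite /lead_coord /= !coordsE oner_eq0.
rewrite cat_uniq; apply/and3P; split.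
- apply: allpairs_uniq; rewrite ?iota_uniq // => -[k l] [k' l'] _ _ /=.
  by case/coords_inj => /eqP + _ /eqP; rewrite !natK => /eqP-> /eqP->.
- apply/hasPn => a a_inf; apply/allpairsP => -[[k l] [_ _ akl]].
  have /eqP : a 0 1 = 1 by rewrite akl coordsE.
  by move: a_inf; rewrite !inE => /or3P[]/eqP->;
     rewrite coordsE eq_sym oner_eq0.
rewrite /= !inE !negb_or !andbT -andbA; apply/and3P; split; apply/eqP.
- by case/coords_inj => /eqP; rewrite eq_sym oner_eq0.
- by case/coords_inj => /eqP; rewrite eq_sym oner_eq0.
- by case/coords_inj => _ _ /eqP; rewrite eq_sym oner_eq0.
Qed.

Definition grid_mult v := count (incident (K := K) ^~ v) (grid_vert ++ grid_hor).

Lemma grid_mult_grid_pt k l :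
  grid_mult (grid_pt k l)
    = ((k < n) + (1 < l < n.+2) + (l == k) + (l == k.+1))%N.
Proof.
rewrite /grid_mult !count_cat !count_map /=.
have [_ _ -> -> ->] := incident_grid_pt k l 0.
rewrite (eq_count (a2 := pred1 k)); last first.
  by move=> j /=; have [-> _ _ _ _] := incident_grid_pt k l j.
rewrite [X in (_ + (X + _))%N](eq_count (a2 := pred1 l)); last first.
  by move=> j /=; have [_ -> _ _ _] := incident_grid_pt k l j.
rewrite !count_uniq_mem ?iota_uniq // !mem_iota /=; lia.
Qed.

Lemma grid_mult_inf :
  [/\ grid_mult (coords 0 0 1) = n.+1, grid_mult (coords 1 0 0) = n.+1
    & grid_mult (coords 1 0 1) = 3%N].
Proof.
have cE (v : 'rV[K]_3) (b c : bool) :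
    (forall j, (v 0 0 == j%:R * v 0 1) = b) ->
    (forall j, (v 0 2 == j%:R * v 0 1) = c) ->
    grid_mult v = (b * n + (v 0 1 == 0)%R + c * n + (v 0 2 == v 0 0)%R
      + (v 0 2 == v 0 0 + v 0 1)%R)%N.
  move=> vb vc; rewrite /grid_mult !count_cat !count_map /=.
  have [_ _ -> -> ->] := incident_grid v 0.
  rewrite (eq_count (a2 := fun=> b)); last first.
    by move=> j /=; have [-> _ _ _ _] := incident_grid v j.
  rewrite [X in (_ + (X + _))%N](eq_count (a2 := fun=> c)); last first.
    by move=> j /=; have [_ -> _ _ _] := incident_grid v j.
  have cst (d : bool) m : count (fun=> d) (iota m n) = (d * n)%N.
    by case: d; rewrite ?count_predT ?count_pred0 ?size_iota ?mul1n.
  by rewrite !cst; lia.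
split; [rewrite (cE _ true false)|rewrite (cE _ false true)|
        rewrite (cE _ false false)];
  by move=> *; rewrite !coordsE ?mulr0 ?addr0 ?eqxx ?oner_eq0
        ?[0 == 1 :> K]eq_sym ?oner_eq0 //=; lia.
Qed.

Lemma grid_pt_of (v : 'rV[K]_3) k l :
  v 0 0 == k%:R * v 0 1 -> v 0 2 == l%:R * v 0 1 -> v = v 0 1 *: grid_pt k l.
Proof.
move=> /eqP v0 /eqP v2; apply: row3P; rewrite !mxE /=.
- by rewrite v0 mulrC.
- by rewrite mulr1.
- by rewrite v2 mulrC.
Qed.

(** Two distinct lines of the arrangement that meet at infinity meet in one of the
    three listed directions.  Otherwise they are of different kinds (vertical,
    horizontal, diagonal), and the coordinates of the crossing are integers
    between 0 and n + 1. *)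
Lemma grid_points_complete (v : 'rV[K]_3) : v != 0 -> (1 < grid_mult v)%N ->
  exists2 w, w \in grid_points & exists2 c, c != 0 & v = c *: w.
Proof.
move=> v0; rewrite /grid_mult -size_filter => v_mult.
have [ul _ _] := distinct_grid_lines.
have [a [b [ab av bv]]] : exists a b, [/\ a != b,
    a \in [seq a <- grid_vert ++ grid_hor | incident a v]
  & b \in [seq a <- grid_vert ++ grid_hor | incident a v]].
  have := filter_uniq (incident (K := K) ^~ v) ul.
  case: [seq _ <- _ | _] v_mult => [|a [|b s]] //= _ /andP[a_s _].
  exists a, b; rewrite !inE !eqxx orbT; split=> //.
  by apply: contraNneq a_s => ->; rewrite mem_head.
have inv a' : a' \in [seq a <- grid_vert ++ grid_hor | incident a v] ->
    [\/ exists2 j, (j < n)%N & a' = vertical j /\ v 0 0 == j%:R * v 0 1,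
      exists2 j, (1 < j < n.+2)%N & a' = horizontal j /\ v 0 2 == j%:R * v 0 1,
      a' = line_at_infinity /\ v 0 1 == 0 |
      a' = diagonal /\ v 0 2 == v 0 0 \/
      a' = diagonal_succ /\ v 0 2 == v 0 0 + v 0 1].
  rewrite mem_filter => /andP[va]; rewrite !mem_cat !inE.
  case/orP => /orP[/mapP[j]|].
  - rewrite mem_iota => /andP[_ jn] aj; constructor 1; exists j => //.
    by have [<- _ _ _ _] := incident_grid v j; rewrite -aj.
  - move=> /eqP ai; constructor 3; split=> //.
    by have [_ _ <- _ _] := incident_grid v 0; rewrite -ai.
  - rewrite mem_iota => jn aj; constructor 2; exists j; first by rewrite -add2n.
    by have [_ <- _ _ _] := incident_grid v j; rewrite -aj.
  - by case/orP => /eqP ai; constructor 4; [left|right]; split=> //;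
      have [_ _ _ e1 e2] := incident_grid v 0; rewrite -?e1 -?e2 -ai.
have [v1|v1] := eqVneq (v 0 1) 0.
  have {inv} inv a' : a' \in [seq a <- grid_vert ++ grid_hor | incident a v] ->
      a' = line_at_infinity \/ [\/ v 0 0 = 0, v 0 2 = 0 | v 0 2 = v 0 0].
    case/inv => [[j _ [_]]|[j _ [_]]|[-> _]|[[_ /eqP]|[_]]]; last first.
    - by rewrite v1 addr0 => /eqP; right; constructor 3.
    - by right; constructor 3.
    - by left.
    - by rewrite v1 mulr0 => /eqP; right; constructor 2.
    - by rewrite v1 mulr0 => /eqP; right; constructor 1.
  have {inv av bv} : [\/ v 0 0 = 0, v 0 2 = 0 | v 0 2 = v 0 0].
    by case: (inv a av) => // ai; case: (inv b bv) => // bi; rewrite ai bi eqxx in ab.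
  have nz c w : v = c *: w -> exists2 c, c != 0 & v = c *: w.
    move=> vcw; exists c => //; apply: contraNneq v0 => c0.
    by rewrite vcw c0 scale0r.
  case=> v02.
  - exists (coords 0 0 1); first by rewrite mem_cat !inE eqxx orbT.
    by apply: (nz (v 0 2)); apply: row3P; rewrite !mxE /= ?mulr0 ?mulr1.
  - exists (coords 1 0 0); first by rewrite mem_cat !inE eqxx !orbT.
    by apply: (nz (v 0 0)); apply: row3P; rewrite !mxE /= ?mulr0 ?mulr1.
  - exists (coords 1 0 1); first by rewrite mem_cat !inE eqxx !orbT.
    by apply: (nz (v 0 0)); apply: row3P; rewrite !mxE /= ?mulr0 ?mulr1.
suff [k [l [kn ln vk vl]]] : exists k l, [/\ (k < n.+2)%N, (l < n.+2)%N,
    v 0 0 == k%:R * v 0 1 & v 0 2 == l%:R * v 0 1].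
  exists (grid_pt k l); last by exists (v 0 1) => //; apply: grid_pt_of.
  by rewrite mem_cat; apply/orP; left; apply/allpairsP; exists (k, l);
     rewrite !mem_iota.
set G := exists k l, _.
have VH j k : (j < n)%N -> v 0 0 == j%:R * v 0 1 ->
    (1 < k < n.+2)%N -> v 0 2 == k%:R * v 0 1 -> G.
  by move=> jn vj /andP[k1 kn] vk; exists j, k; split=> //; lia.
have VD j : (j < n)%N -> v 0 0 == j%:R * v 0 1 ->
    v 0 2 == v 0 0 \/ v 0 2 == v 0 0 + v 0 1 -> G.
  move=> jn vj [/eqP vd|/eqP vd].
    by exists j, j; split=> //; rewrite ?vd //; lia.
  exists j, j.+1; split=> //; try lia.
  by rewrite vd (eqP vj) -natr1 mulrDl mul1r.
have HD k : (1 < k < n.+2)%N -> v 0 2 == k%:R * v 0 1 ->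
    v 0 2 == v 0 0 \/ v 0 2 == v 0 0 + v 0 1 -> G.
  case: k => // k /andP[k1 kn] vk [/eqP vd|/eqP vd].
    by exists k.+1, k.+1; split=> //; rewrite -?vd //; lia.
  exists k, k.+1; split=> //; try lia.
  by rewrite -(addrK (v 0 1) (v 0 0)) -vd (eqP vk) -natr1 mulrDl mul1r addrK.
have vK j k : j%:R * v 0 1 = k%:R * v 0 1 -> j = k.
  by move/(mulIf v1)/eqP; rewrite natK => /eqP.
case: (inv a av) => [[j jn [aj vj]]|[j jn [aj vj]]|[_]|ad];
  last 1 first; last by rewrite (negPf v1).
all: case: (inv b bv) => [[k kn [bk vk]]|[k kn [bk vk]]|[_]|bd].
all: try by rewrite (negPf v1).
- by apply: (VD k) => //; case: ad => [[_ ?]|[_ ?]]; [left|right].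
- by apply: (HD k) => //; case: ad => [[_ ?]|[_ ?]]; [left|right].
- have v1F : v 0 0 = v 0 0 + v 0 1 -> G.
    rewrite -[X in X = _]addr0 => /addrI/esym/eqP; by rewrite (negPf v1).
  case: ad bd ab => [[-> /eqP va]|[-> /eqP va]] [[-> /eqP vb]|[-> /eqP vb]];
    rewrite ?eqxx // => _; apply: v1F;
    first [exact: etrans (esym va) vb | exact: etrans (esym vb) va].
- by case/eqP: ab; rewrite aj bk; congr vertical; apply: vK; rewrite -(eqP vj) (eqP vk).
- exact: VH vj _ vk.
- by apply: (VD j) => //; case: bd => [[_ ?]|[_ ?]]; [left|right].
- exact: VH vk _ vj.
- by case/eqP: ab; rewrite aj bk; congr horizontal; apply: vK; rewrite -(eqP vj) (eqP vk).
- by apply: (HD j) => //; case: bd => [[_ ?]|[_ ?]]; [left|right].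
Qed.

(** Write b1 and b2 for the truth values of k < n and 2 <= l.  Off the diagonals
    (m - 1)^2 = (b1 + b2 - 1)^2 is replaced by b1 b2, the two being equal in
    truncated arithmetic; on them (m - 1)^2 = (b1 + b2)^2 = b1 b2 + e with
    e = b1 + b2 + b1 b2.  The n^2 points with b1 = b2 = 1 and the two diagonals
    are then counted separately. *)
Lemma grid_tjurina_sum : (1 < n)%N ->
  (\sum_(v <- grid_points) (grid_mult v - 1) ^ 2 = 3 * n ^ 2 + 6 * n + 1)%N.
Proof.
move=> n1; have [m1 m2 m3] := grid_mult_inf.
transitivity (\sum_(k <- iota 0 n.+2) \sum_(l <- iota 0 n.+2)
    (grid_mult (grid_pt k l) - 1) ^ 2 + (n ^ 2 + n ^ 2 + 4))%N.
  rewrite big_cat big_allpairs_dep !big_cons big_nil m1 m2 m3.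
  by congr (_ + _)%N; rewrite /= addn0 addnA subn1.
pose b1 k : nat := (k < n)%N; pose b2 l : nat := (1 < l)%N.
pose e k l := (b1 k + b2 l + b1 k * b2 l)%N.
have termE k l : l \in iota 0 n.+2 ->
    ((grid_mult (grid_pt k l) - 1) ^ 2
     = b1 k * b2 l + (l == k) * e k k + (l == k.+1) * e k k.+1)%N.
  rewrite mem_iota grid_mult_grid_pt /e /b1 /b2 => /andP[_ ln].
  rewrite [(1 < l < n.+2)%N](_ : _ = (1 < l)%N); last by lia.
  have [<-|_] := eqVneq l k; first by case: ltnP; case: ltnP; lia.
  have [<-|_] := eqVneq l k.+1; by case: ltnP; case: ltnP; lia.
(* Each diagonal meets the row in one point, if at all. *)
have pick j (c : nat) :
    (\sum_(l <- iota 0 n.+2) (l == j) * c = (j < n.+2) * c)%N.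
  rewrite -big_distrl /=; congr (_ * _)%N.
  have := sum1_count (iota 0 n.+2) (pred1 j).
  rewrite count_uniq_mem ?iota_uniq // mem_iota /= add0n => <-.
  by rewrite [RHS]big_mkcond.
have rowE k : (\sum_(l <- iota 0 n.+2) (grid_mult (grid_pt k l) - 1) ^ 2
    = b1 k * n + (k < n.+2) * e k k + (k.+1 < n.+2) * e k k.+1)%N.
  rewrite big_seq (eq_bigr _ (termE k)) -big_seq !big_split !pick.
  rewrite -big_distrr (iotaD 0 2 n : iota 0 n.+2 = _) big_cat /=.
  rewrite !big_cons big_nil /b2 /= big_seq (eq_bigr (fun=> 1%N)).
    by rewrite -big_seq sum1_size size_iota.
  by move=> l; rewrite mem_iota => /andP[->].
rewrite (eq_bigr _ (fun k _ => rowE k)).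
move: n1 rowE termE pick; rewrite /e /b1 /b2; case: n => [|[|m]] // _ _ _ _.
(* The rows 0, 1, n and n + 1 are exceptional; each of the others adds n + 6. *)
rewrite (iotaD 0 2 m.+2 : iota 0 m.+4 = _) -(addn2 m) iotaD !big_cat /=.
rewrite !big_cons !big_nil big_seq (eq_bigr (fun=> m + 8)%N).
  rewrite -big_seq big_const_seq count_predT size_iota iter_addn_0.
  by rewrite !add0n !ltnn; nia.
by move=> k; rewrite mem_iota; nia.
Qed.
End SlantedGrid.

(** * The slanted grid is a maximal Tjurina arrangement *)

(** Three crossings of lines of [grid_hor] that no line of [grid_vert] covers. *)
Definition grid_double_pt (K : fieldType) (n : nat) (i : 'I_3) : 'rV[K]_3 :=
  nth 0 [:: grid_pt K n n; grid_pt K n n.+1; grid_pt K n.+1 n.+1] i.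

Section GridArrangement.
Variables (K : fieldType) (n : nat).
Hypothesis natK : forall j k : nat, (j%:R == k%:R :> K) = (j == k).
Hypothesis n1 : (1 < n)%N.

Definition grid_arrangement : line_arrangement K :=
  seq_arrangement (distinct_grid_lines n natK).

Lemma size_grid_vert : size (grid_vert K n) = n.+1.
Proof. by rewrite size_cat size_map size_iota addn1. Qed.

Lemma size_grid_hor : size (grid_hor K n) = n.+2.
Proof. by rewrite size_cat size_map size_iota addn2. Qed.

Lemma grid_tjurina : tjurina grid_arrangement = (3 * n ^ 2 + 6 * n + 1)%N.
Proof.
have multE v : point_mult grid_arrangement <[v]>%VS = grid_mult n v.
  by rewrite point_mult_seq; apply: eq_count => a; rewrite on_line_vline.
have dp := distinct_grid_points n natK.
rewrite (@tjurina_sum _ _ [seq <[v]>%VS | v <- grid_points K n]).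
- by rewrite big_map -(grid_tjurina_sum natK n1); apply: eq_bigr => v _; rewrite multE.
- exact: uniq_vlines.
- move=> p /mapP[v v_in ->]; rewrite dim_vline.
  by have [_ /(_ v v_in) -> _] := dp.
move=> p /dim1_vline[v v0 ->]; rewrite multE.
case/(grid_points_complete natK v0) => w w_in [c c0 ->].
by rewrite vlineZ // map_f.
Qed.

Lemma grid_mdr : is_mdr grid_arrangement n.+2.
Proof.
rewrite -size_grid_hor.
apply: (@pencil_mdr K (grid_vert K n) (grid_hor K n) _ _ _ _
  (fun i => grid_double_pt K n i 0)).
- move=> a; rewrite mem_cat inE => /orP[/mapP[j _ ->]|/eqP->];
    by rewrite coordsE.
- rewrite size_cat size_grid_vert size_grid_hor.
  by rewrite (natK _ 0).
- move=> a; rewrite mem_cat !inE => /orP[/mapP[j _ ->]|/orP[]/eqP->];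
    by rewrite coordsE.
- move=> c cP; have := (cP 0, cP 1, cP 2).
  rewrite /grid_double_pt /= !meval_linear_form !sum_ord3 !coordsE !mulr1.
  move=> [[e0 e1] e2].
  have c2 : c 0 2 = 0.
    transitivity (c 0 0 * n%:R + c 0 1 + c 0 2 * n.+1%:R
      - (c 0 0 * n%:R + c 0 1 + c 0 2 * n%:R)); first by rewrite -natr1; ring.
    by rewrite e0 e1 subrr.
  have c0 : c 0 0 = 0.
    transitivity (c 0 0 * n.+1%:R + c 0 1 + c 0 2 * n.+1%:R
      - (c 0 0 * n%:R + c 0 1 + c 0 2 * n.+1%:R)); first by rewrite -natr1; ring.
    by rewrite e1 e2 subrr.
  apply: row3P; rewrite ?mxE //.
  by move: e0; rewrite c0 c2 !mul0r add0r addr0.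
- have off k l a : (n <= k)%N -> a \in grid_vert K n ->
      (linear_form a).@[grid_pt K k l 0] != 0.
    move=> nk a_in; rewrite -/(incident a _).
    move: a_in; rewrite mem_cat inE => /orP[/mapP[j]|/eqP->].
      rewrite mem_iota => /andP[_ jn] ->.
      have [-> _ _ _ _] := incident_grid_pt natK k l j.
      by apply: contraTneq jn => ->; rewrite -leqNgt.
    by have [_ _ -> _ _] := incident_grid_pt natK k l 0.
  by move=> [[|[|[|//]]] lt_i] a a_in; apply: off.
have hor j : (1 < j < n.+2)%N -> horizontal K j \in grid_hor K n.
  by move=> jn; rewrite mem_cat map_f // mem_iota add2n.
have hd j : horizontal K j != diagonal K.
  by apply/eqP => /coords_inj[/eqP]; rewrite eq_sym oppr_eq0 oner_eq0.
have hd' j : horizontal K j != diagonal_succ K.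
  by apply/eqP => /coords_inj[/eqP]; rewrite eq_sym oppr_eq0 oner_eq0.
have d_in : diagonal K \in grid_hor K n by rewrite mem_cat !inE eqxx orbT.
have d'_in : diagonal_succ K \in grid_hor K n by rewrite mem_cat !inE eqxx !orbT.
have on a k l : incident a (grid_pt K k l) -> (linear_form a).@[grid_pt K k l 0] = 0.
  by move/eqP.
move=> [[|[|[|//]]] lt_i]; rewrite /grid_double_pt /=.
- exists (horizontal K n), (diagonal K); split=> //; try apply: on.
  + by apply: hor; rewrite n1 /=.
  + by have [_ -> _ _ _] := incident_grid_pt natK n n n.
  + by have [_ _ _ -> _] := incident_grid_pt natK n n n.
- exists (horizontal K n.+1), (diagonal_succ K); split=> //; try apply: on.
  + by apply: hor; lia.
  + by have [_ -> _ _ _] := incident_grid_pt natK n n.+1 n.+1.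
  + by have [_ _ _ _ ->] := incident_grid_pt natK n n.+1 n.+1.
- exists (horizontal K n.+1), (diagonal K); split=> //; try apply: on.
  + by apply: hor; lia.
  + by have [_ -> _ _ _] := incident_grid_pt natK n.+1 n.+1 n.+1.
  + by have [_ _ _ -> _] := incident_grid_pt natK n.+1 n.+1 n.+1.
- by rewrite size_grid_hor size_grid_vert.
- by rewrite size_grid_vert.
Qed.
End GridArrangement.

Lemma grid_arrangement_real (R : realType) (K : fieldType)
    (iota : {rmorphism R -> K}) n
    (natK : forall j k : nat, (j%:R == k%:R :> K) = (j == k)) :
  real_arrangement iota (grid_arrangement n natK).
Proof.
have mapE x y z : map_mx iota (coords x y z) = coords (iota x) (iota y) (iota z).
  by apply: row3P; rewrite !mxE.
move=> i; exists 1.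
suff [b ->] : exists b, line_coef (grid_arrangement n natK) i = map_mx iota b.
  by exists b; rewrite oner_neq0 scale1r.
have : line_coef (grid_arrangement n natK) i \in grid_vert K n ++ grid_hor K n.
  exact: mem_nth.
rewrite !mem_cat !inE => /orP[]/orP[/mapP[j _ ->]|].
- by exists (vertical R j); rewrite mapE rmorphN rmorph_nat rmorph1 rmorph0.
- by move/eqP->; exists (line_at_infinity R); rewrite mapE rmorph1 rmorph0.
- by exists (horizontal R j); rewrite mapE rmorphN rmorph_nat rmorph1 rmorph0.
case/orP => /eqP->.
- by exists (diagonal R); rewrite mapE rmorphN rmorph1 rmorph0.
- by exists (diagonal_succ R); rewrite mapE rmorphN rmorph1.
Qed.

Theorem corollary4p5 (R : realType) (K : fieldType) (iota : {rmorphism R -> K})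
    (r : nat) (hd : (7 <= 2 * r - 1)%N) :
  exists A : line_arrangement K,
    real_arrangement iota A /\ maximal_tjurina A (2 * r - 1) r.
Proof.
have natK j k : (j%:R == k%:R :> K) = (j == k).
  by rewrite -!(rmorph_nat iota) (inj_eq (fmorph_inj iota)) Num.Theory.eqr_nat.
have [n n1 rE] : exists2 n, (1 < n)%N & r = n.+2 by exists (r - 2)%N; lia.
exists (grid_arrangement n natK); split; first exact: grid_arrangement_real.
rewrite rE; split; last 1 first.
- rewrite grid_tjurina // /tau_max ifN; last by lia.
  rewrite (_ : 2 * n.+2 - (2 * n.+2 - 1) + 2 = 3)%N; last by lia.
  by rewrite (_ : 'C(3, 2) = 3)%N //; nia.
- by rewrite /= size_cat size_grid_vert size_grid_hor; lia.
- exact: grid_mdr.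
Qed.
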